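(* Independent Cascade (IC) models and Independent Generalized Threshold (IGT) models, with submodular utility, are strongly submodular SDMs.
   Context: $V$ is a finite set. A stochastic diffusion model (SDM) $\mathcal{G}(V,H)$ is a distribution over families $\phi=(\phi_v)_{v\in V}$ of monotone non-decreasing functions $\phi_v:2^{V\setminus\{v\}}\to\{0,1\}$, together with a utility $H:2^V\to\mathbb{R}_{\ge0}$ that is monotone non-decreasing with $H(\emptyset)=0$. A diffusion from a seed set $S\subset V$ has $\mathrm{Reach}^0(\phi,S)=S$. At each step all active nodes remain active and every inactive node $v$ whose activation function equals $1$ on the current active set is activated: $\mathrm{Reach}^{t+1}(\phi,S)=\mathrm{Reach}^t(\phi,S)\cup\{v\notin\mathrm{Reach}^t(\phi,S):\phi_v(\mathrm{Reach}^t(\phi,S))=1\}$. The influence function is $I^\tau_{\mathcal{G}}(S)=\mathbb{E}_{\phi\sim\mathcal{G}}[H(\mathrm{Reach}^\tau(\phi,S))]$. The SDM is independent if the activation functions $\phi_v$ of different nodes are independent random variables. IC model: a finite directed graph $(V,\mathcal{E})$ with probabilities $p_e$, $e\in\mathcal{E}$; each edge $e$ is live independently with probability $p_e$, giving a random set $E$ of live edges, and $\phi_v(T)=1$ if and only if $E$ contains an edge from a node of $T$ to $v$. IGT model: monotone submodular functions $f_v:2^V\to[0,1]$, $v\in V$, and independent thresholds $\theta_v\sim U[0,1]$; $\phi_v(T)=1$ if and only if $\theta_v\le f_v(T)$. Reduced model: for an independent SDM $\mathcal{G}(V,H)$ with submodular utility $H$ and a set $T\subset V$, the reduced model $\mathcal{G}'(V',H')$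 of $\mathcal{G}$ with respect to $T$ has node set $V'=V\setminus T$. Its activation functions are independent and, for each $v\in V\setminus T$, $\phi'_v$ is obtained by drawing $\phi_v\sim\mathcal{G}$ conditioned on $\phi_v(T)=0$ and taking $\phi'_v(S)=\phi_v(S\cup T)$ for all $S\subset V\setminus(T\cup\{v\})$. Its utility is the marginal utility $H'(S)=H(S\cup T)-H(T)$ for all $S\subset V\setminus T$. An independent SDM $\mathcal{G}(V,H)$ is strongly submodular if $H$ is submodular and, for every reduced model $\mathcal{G}'$ of $\mathcal{G}$ and every step limit $\tau\ge0$, the influence function $I^\tau_{\mathcal{G}'}$ is submodular. *)

(* Defs.v *)
From HB Require Import structures.
From mathcomp Require Import all_boot all_order all_algebra.
From mathcomp Require Import all_classical all_reals all_analysis.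
Import Order.TTheory GRing.Theory Num.Theory.
Set Implicit Arguments.
Unset Strict Implicit.
Unset Printing Implicit Defensive.
Local Open Scope ring_scope.

Section SetFunctions.
Variables (R : realType) (V : finType).
Implicit Types (F : {set V} -> R).

Definition nondecreasing_setfun F := forall A B : {set V}, A \subset B -> F A <= F B.

Definition submodular F :=
  forall A B : {set V}, F (A :|: B) + F (A :&: B) <= F A + F B.

Definition is_utility F :=
  [/\ forall A, 0 <= F A, nondecreasing_setfun F & F finset.set0 = 0].

End SetFunctions.

Section Diffusion.
Variables (R : realType) (V : finType).

(* A function [2^(V \ {v}) -> {0,1}] is encoded as the function on [2^V] that
   disregards whether its argument contains [v]; see [activation_function]. *)
Definition act_fun := {ffun {set V} -> bool}.
Definition act_family := {ffun V -> act_fun}.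

Definition activation_function (v : V) (g : act_fun) :=
  (forall A, g A = g (A :\ v)) /\
  (forall A B : {set V}, A \subset B -> g A -> g B).

(* The set of families is finite, so a distribution is a mass function. *)
Record sdm := SDM { law : act_family -> R; utility : {set V} -> R }.

Definition is_sdm (G : sdm) :=
  [/\ forall phi, 0 <= law G phi,
      \sum_phi law G phi = 1,
      forall phi, law G phi != 0 -> forall v, activation_function v (phi v)
    & is_utility (utility G)].

Definition Prob (G : sdm) (E : pred act_family) : R := \sum_(phi | E phi) law G phi.

Definition independent (G : sdm) :=
  forall B : V -> {set act_fun},
    Prob G (fun phi => [forall v, phi v \in B v]) =
    \prod_v Prob G (fun phi => phi v \in B v).

Fixpoint reach (phi : act_family) (S : {set V}) (t : nat) : {set V} :=
  if t is t'.+1 then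
    let A := reach phi S t' in A :|: [set v | (v \notin A) && phi v A]
  else S.

Definition influence (G : sdm) (tau : nat) (S : {set V}) : R :=
  \sum_phi law G phi * utility G (reach phi S tau).

End Diffusion.

Section Reduced.
Variables (R : realType) (V : finType) (G : sdm R V) (T : {set V}).

Definition nodes_out : finType := {v : V | v \notin T}.

Definition join_out (S : {set nodes_out}) : {set V} := (val @: S) :|: T.

Definition restrict_out (g : act_fun V) : act_fun nodes_out :=
  [ffun S => g (join_out S)].

(* The conditioning events have positive probability; otherwise the reduced
   model with respect to [T] does not exist. *)
Definition reducible :=
  forall v, v \notin T -> 0 < Prob G (fun phi => ~~ phi v T).

Definition reduced : sdm R nodes_out :=
  {| law := fun psi => \prod_(v : nodes_out)
       (Prob G (fun phi => ~~ phi (val v) T &&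
                           (restrict_out (phi (val v)) == psi v)) /
        Prob G (fun phi => ~~ phi (val v) T));
     utility := fun S => utility G (join_out S) - utility G T |}.

End Reduced.

Definition strongly_submodular (R : realType) (V : finType) (G : sdm R V) :=
  [/\ is_sdm G, independent G, submodular (utility G) &
      forall T : {set V}, reducible G T ->
        forall tau : nat, submodular (influence (reduced G T) tau)].

Section IndependentCascade.
Variables (R : realType) (V : finType).
Variables (E : {set V * V}) (p : V * V -> R) (H : {set V} -> R).

Definition ic_family (L : {set V * V}) : act_family V :=
  [ffun v => [ffun A : {set V} => [exists u in A :\ v, (u, v) \in L]]].

Definition live_prob (L : {set V * V}) : R :=
  (\prod_(e in L) p e) * \prod_(e in E :\: L) (1 - p e).

Definition ic_sdm : sdm R V :=
  {| law := fun phi => \sum_(L : {set V * V} | (L \subset E) &&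
                                               (ic_family L == phi)) live_prob L;
     utility := H |}.

End IndependentCascade.

Section GeneralizedThreshold.
Variables (d : measure_display) (Omega : measurableType d) (R : realType).
Variables (P : probability Omega R) (V : finType).

Definition independent_RVs (X : V -> {RV P >-> R}) :=
  forall (J : {set V}) (B : V -> set R), (forall v, measurable (B v)) ->
    fine (P [set w | forall v, v \in J -> B v (X v w)]%classic) =
    \prod_(v in J) fine (P (X v @^-1` B v)%classic).

Definition uniform01 (X : {RV P >-> R}) :=
  forall B : set R, measurable B ->
    distribution P X B = uniform_prob (@ltr01 R) B.

Definition igt_family (f : V -> {set V} -> R) (theta : V -> R) : act_family V :=
  [ffun v => [ffun A : {set V} => theta v <= f v (A :\ v)]].

Definition igt_sdm (f : V -> {set V} -> R) (theta : V -> {RV P >-> R})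
    (H : {set V} -> R) : sdm R V :=
  {| law := fun phi =>
       fine (P [set w | igt_family f (fun v => theta v w) = phi]%classic);
     utility := H |}.

End GeneralizedThreshold.

(* Main.v *)
(* By monotonicity, the influence of an independent SDM depends only on the
   activation probabilities f_v(A) = P(phi_v(A) = 1): a node that was not activated
   by A is activated by a larger set B with probability
   (f_v(B) - f_v(A)) / (1 - f_v(A)).  Passing to a reduced model rescales f_v
   affinely, so it suffices that the influence is submodular whenever every f_v is.

   The seeds are generalized to schedules: increasing sequences of sets forced to
   be active at each step, with the lattice operations taken pointwise.  One shows
   by induction on the number of steps that the expected utility is monotone and
   submodular on schedules.  After the first step the value is a function Phi of the
   remaining schedule and of the vector y of activation levels, affine in each y_v.
   Its slope in y_v is the gain from forcing v active now rather than one step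
   later, because a node whose threshold is just above y_v is activated at the
   next step anyway.  That gain is a difference of values on two schedules; hence
   the induction hypothesis makes the slope nonnegative and nonincreasing in the
   schedule and in the other levels, and these diminishing returns combine with the
   submodularity of the f_v. *)

Require Import Defs.
From mathcomp Require Import all_boot all_order all_algebra.
From mathcomp Require Import all_classical all_reals all_analysis.
From mathcomp Require Import ring lra fintype finset.
Import Order.TTheory GRing.Theory Num.Theory.
Set Implicit Arguments.
Unset Strict Implicit.
Unset Printing Implicit Defensive.
Local Open Scope ring_scope.

(** * Conditional activation probabilities of uniform thresholds *)

Section Hazard.
Variable R : realFieldType.
Implicit Types x y z : R.

(* The probability that a threshold uniform on [x, 1] is at most [y]; it is [0]
   for [x = 1], because then [1 - x] has inverse [0]. *)
Definition hazard x y := (y - x) / (1 - x).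

Lemma hazard0x y : hazard 0 y = y.
Proof. by rewrite /hazard !subr0 divr1. Qed.

Lemma hazardB x y z : hazard x z - hazard x y = (z - y) / (1 - x).
Proof. by rewrite /hazard -mulrBl; congr (_ / _); ring. Qed.

Lemma hazard_ge0 x y : x <= y -> y <= 1 -> 0 <= hazard x y.
Proof. by move=> xy y1; rewrite divr_ge0 ?subr_ge0// (le_trans xy). Qed.

Lemma hazard_le1 x y : x <= y -> y <= 1 -> hazard x y <= 1.
Proof.
move=> xy y1; have [x1|x1] := eqVneq x 1.
  by rewrite /hazard x1 subrr invr0 mulr0.
have xlt1 : 0 < 1 - x by rewrite subr_gt0 lt_neqAle x1 (le_trans xy).
by rewrite ler_pdivrMr// mul1r lerB.
Qed.

Lemma hazard_mono x y z : x <= y -> y <= z -> z <= 1 -> hazard x y <= hazard x z.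
Proof.
move=> xy yz z1; rewrite -subr_ge0 hazardB divr_ge0// subr_ge0//.
by rewrite (le_trans xy)// (le_trans yz).
Qed.

(** Survival probabilities multiply along increasing levels. For [y = 1] also [z = 1], and the
    convention [hazard 1 1 = 0] makes the second factor 1. *)
Lemma onem_hazardM x y z : x <= y -> y <= z -> z <= 1 ->
  (1 - hazard x y) * (1 - hazard y z) = 1 - hazard x z.
Proof.
move=> xy yz z1; rewrite /hazard.
have [y1|y1] := eqVneq y 1.
  have -> : z = 1 by apply/le_anti; rewrite z1 -y1.
  by rewrite y1 subrr mul0r subr0 mulr1.
have y0 : 1 - y != 0 by rewrite subr_eq0 eq_sym.
have x0 : 1 - x != 0.
  rewrite subr_eq0 eq_sym; apply: contra y1 => /eqP x1.
  by apply/eqP/le_anti; rewrite -[X in X <= y]x1 xy (le_trans yz).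
by field; rewrite x0 y0.
Qed.

End Hazard.

(** * Multilinear extensions and coordinatewise monotonicity *)

Section Multilinear.
Variables (R : realFieldType) (V : finType).
Implicit Types (F G : {set V} -> R) (u y : V -> R).

Definition set_weight u (Y : {set V}) : R :=
  \prod_v (if v \in Y then u v else 1 - u v).

(** The multilinear extension: the expectation of [F] at a random set that contains each [v]
    independently with probability [u v]. *)
Definition mle F u := \sum_(Y : {set V}) set_weight u Y * F Y.

Definition upd y (v : V) (t : R) : V -> R := fun w => if w == v then t else y w.

Lemma upd_eq y v t : upd y v t v = t.
Proof. by rewrite /upd eqxx. Qed.

Lemma upd_neq y v t w : w != v -> upd y v t w = y w.
Proof. by rewrite /upd => /negbTE ->. Qed.

Lemma upd_upd y v t t' : upd (upd y v t) v t' = upd y v t'.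
Proof. by apply/funext => w; rewrite /upd; case: eqP. Qed.

Lemma sum_set_weight u : \sum_(Y : {set V}) set_weight u Y = 1.
Proof.
transitivity (\prod_(v : V) (u v + (1 - u v))).
  by rewrite bigA_distr.
by apply: big1 => v _; rewrite addrC subrK.
Qed.

Lemma set_weight_ge0 u Y : (forall v, 0 <= u v <= 1) -> 0 <= set_weight u Y.
Proof.
move=> u01; apply: prodr_ge0 => v _.
by case: ifP => _; have /andP[u0 u1] := u01 v; rewrite ?subr_ge0.
Qed.

Lemma eq_mle F G u : F =1 G -> mle F u = mle G u.
Proof. by move=> FG; apply: eq_bigr => Y _; rewrite FG. Qed.

Lemma mleB F G u : mle F u - mle G u = mle (fun Y => F Y - G Y) u.
Proof. by rewrite -sumrB; apply: eq_bigr => Y _; rewrite mulrBr. Qed.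

Lemma mleD F G u : mle F u + mle G u = mle (fun Y => F Y + G Y) u.
Proof. by rewrite -big_split; apply: eq_bigr => Y _; rewrite mulrDr. Qed.

Lemma ler_mle F G u : (forall v, 0 <= u v <= 1) -> (forall Y, F Y <= G Y) ->
  mle F u <= mle G u.
Proof.
move=> u01 FG; apply: ler_sum => Y _.
by apply: ler_wpM2l => //; exact: set_weight_ge0.
Qed.

Lemma set_split_sum (v : V) F :
  \sum_(Y : {set V}) F Y = \sum_(Y : {set V} | v \notin Y) (F (v |: Y) + F Y).
Proof.
rewrite (bigID (fun Y : {set V} => v \in Y)) /= big_split /=; congr (_ + _).
rewrite (reindex_onto (fun Y => v |: Y) (fun Y => Y :\ v)) /=; last first.
  by move=> Y vY; rewrite setD1K.
apply: eq_bigl => Y; rewrite setU11 /=.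
apply/eqP/idP => [<-|vY]; first by rewrite setD11.
by rewrite setU1K.
Qed.

Lemma mle_split (v : V) F u :
  mle F u = \sum_(Y : {set V} | v \notin Y)
    (\prod_(w | w != v) (if w \in Y then u w else 1 - u w)) *
    (u v * F (v |: Y) + (1 - u v) * F Y).
Proof.
rewrite /mle (set_split_sum v); apply: eq_bigr => Y vY.
rewrite /set_weight (bigD1 v) //= setU11 [in X in _ + X](bigD1 v) //= (negbTE vY).
set p1 := \prod_(_ | _) _; set p2 := \prod_(_ | _) _.
have -> : p1 = p2.
  by apply: eq_bigr => w wv; rewrite !inE (negbTE wv).
by ring.
Qed.

(** The path from [y] to [y'] changes one coordinate at a time and stays between the two points,
    hence in the box. *)
Lemma box_mono (F : (V -> R) -> R) (lo hi : V -> R) :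
  (forall y v t, (forall w, lo w <= y w) -> (forall w, y w <= hi w) ->
     y v <= t -> t <= hi v -> F y <= F (upd y v t)) ->
  forall y y', (forall w, lo w <= y w) -> (forall w, y w <= y' w) ->
    (forall w, y' w <= hi w) -> F y <= F y'.
Proof.
move=> Fupd y y' loy yy' y'hi.
pose mix (r : seq V) w := if w \in r then y' w else y w.
have mixP r w : y w <= mix r w <= y' w.
  by rewrite /mix; case: ifP; rewrite lexx yy'.
have Fmix r : F y <= F (mix r).
  elim: r => [|v r IHr].
    by have -> : mix [::] = y by apply/funext.
  apply: (le_trans IHr).
  have -> : mix (v :: r) = upd (mix r) v (y' v).
    by apply/funext => w; rewrite /mix /upd in_cons; case: eqP => //= ->.
  apply: Fupd => //.
  - by move=> w; apply: (le_trans (loy w)); have /andP[] := mixP r w.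
  - by move=> w; apply: le_trans (y'hi w); have /andP[] := mixP r w.
  - by have /andP[] := mixP r v.
have := Fmix (enum V); congr (_ <= F _).
by apply/funext => w; rewrite /mix mem_enum.
Qed.

End Multilinear.

(** * Submodularity of the threshold process on schedules *)

Section Schedules.
Variable V : finType.
Implicit Types (s t : nat -> {set V}) (A : {set V}).

Definition shift s : nat -> {set V} := fun i => s i.+1.
Definition addset s A : nat -> {set V} := fun i => s i :|: A.
Definition addlate s A : nat -> {set V} := fun i => if i is 0 then s 0%N else s i :|: A.

Definition increasing s := forall i, s i \subset s i.+1.

Lemma increasing_shift s : increasing s -> increasing (shift s).
Proof. by move=> incs i; apply: incs. Qed.

Lemma increasing_addset s A : increasing s -> increasing (addset s A).
Proof. by move=> incs i; apply: setSU. Qed.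

Lemma increasing_addlate s A : increasing s -> increasing (addlate s A).
Proof.
move=> incs [|i] /=; last exact: setSU.
exact: subset_trans (incs 0%N) (subsetUl _ _).
Qed.

Lemma increasing_cup s t : increasing s -> increasing t ->
  increasing (fun i => s i :|: t i).
Proof. by move=> incs inct i; apply: setUSS. Qed.

Lemma increasing_cap s t : increasing s -> increasing t ->
  increasing (fun i => s i :&: t i).
Proof. by move=> incs inct i; apply: setISS. Qed.

Lemma addsetAC s A B : addset (addset s A) B = addset (addset s B) A.
Proof. by apply/funext => i; apply/setP => z; rewrite !inE orbAC. Qed.

Lemma addlate_addset s A B : addlate (addset s A) B = addset (addlate s B) A.
Proof. by apply/funext => -[|i] //=; apply/setP => z; rewrite !inE orbAC. Qed.

Lemma addlate_id s (v : V) : increasing s -> v \in s 0%N ->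
  addlate s [set v] = addset s [set v].
Proof.
move=> incs vs; apply/funext => -[|i] //=.
by apply/setP => z; rewrite !inE; case: eqP => [->|]; rewrite ?vs ?orbF.
Qed.

End Schedules.

(** * Expected utility of the threshold process and its dependence on the levels *)

Section Value.
Variables (R : realFieldType) (V : finType).
Variables (f : V -> {set V} -> R) (H : {set V} -> R).
Implicit Types (s t : nat -> {set V}) (x y : V -> R) (D Y : {set V}).

Definition level (A : {set V}) : V -> R := fun v => f v A.

(* The expected utility after [k] steps of the threshold process in which the
   nodes of [s i] are active from step [i] on, when the thresholds of the nodes
   outside [s 0] are known to exceed the levels [x]. *)
Fixpoint value k x s : R :=
  if k is k'.+1 then
    mle (fun Y => value k' (level (s 0%N)) (addset (shift s) Y))
        (fun v => hazard (x v) (f v (s 0%N)))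
  else H (s 0%N).

Hypothesis fmono : forall v (A B : {set V}), A \subset B -> f v A <= f v B.
Hypothesis f_le1 : forall v A, f v A <= 1.
Hypothesis fsub : forall v (A B : {set V}),
  f v (A :|: B) + f v (A :&: B) <= f v A + f v B.
Hypothesis Hmono : forall A B : {set V}, A \subset B -> H A <= H B.
Hypothesis Hsub : forall A B : {set V}, H (A :|: B) + H (A :&: B) <= H A + H B.

(** Consistency of the conditioning: it keeps the hazards of the next step between 0 and 1. *)
Definition below x s := forall v, x v <= f v (s 0%N).

Lemma below_sub x s t : s 0%N \subset t 0%N -> below x s -> below x t.
Proof. by move=> st xs v; exact: le_trans (xs v) (fmono v st). Qed.

Lemma hazard01 x y s : below y s -> (forall v, x v <= y v) ->
  forall v, 0 <= hazard (x v) (y v) <= 1.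
Proof.
move=> ys xy v; have y1 : y v <= 1 by exact: le_trans (ys v) (f_le1 _ _).
by rewrite hazard_ge0// hazard_le1.
Qed.

(** The threshold of a node that is forced by step 1 is irrelevant: both branches of the split at
    [v] agree, and their weights add up to 1. *)
Lemma value_upd k x s v (c : R) : increasing s -> v \in s 1%N ->
  value k (upd x v c) s = value k x s.
Proof.
case: k => //= k incs vs; rewrite !(mle_split v); apply: eq_bigr => Y vY.
have -> : addset (shift s) (v |: Y) = addset (shift s) Y.
  apply/funext => i; apply/setP => z; rewrite !inE.
  case: eqP => //= ->; rewrite orbT; suff -> : v \in shift s i by [].
  by elim: i => // i; apply/subsetP; exact: incs.
congr (_ * _); last by ring.
by apply: eq_bigr => w wv; rewrite upd_neq.
Qed.

(* Activating [v] one step late is the same as [v] being activated by its own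
   threshold, so the difference only sees the thresholds above [f v (s 0)]. *)
Lemma value_late_affine k (a : R) x s v (c : R) : increasing s ->
  a <= x v -> x v <= f v (s 0%N) -> a <= c -> c <= f v (s 0%N) ->
  (1 - hazard a (x v)) * (value k x s - value k x (addlate s [set v])) =
  (1 - hazard a c) * (value k (upd x v c) s - value k x (addlate s [set v])).
Proof.
case: k => [|k] incs ax xf ac cf /=; first by rewrite subrr !mulr0.
(* The two schedules agree on the branch where [v] fires. On the other one the survival probability
   from [y v] merges with the prefactor into one from [a], which no longer involves [y v]. *)
have E (y : V -> R) : a <= y v -> y v <= f v (s 0%N) ->
    (forall w, w != v -> y w = x w) ->
    (1 - hazard a (y v)) * (value k.+1 y s - value k.+1 x (addlate s [set v])) =
    (1 - hazard a (f v (s 0%N))) * \sum_(Y : {set V} | v \notin Y)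
      (\prod_(w | w != v) (if w \in Y then hazard (x w) (f w (s 0%N))
                            else 1 - hazard (x w) (f w (s 0%N)))) *
      (value k (level (s 0%N)) (addset (shift s) Y) -
       value k (level (s 0%N)) (addset (shift s) (v |: Y))).
  move=> ay yf yx /=; rewrite !(mle_split v) -sumrB !big_distrr /=.
  apply: eq_bigr => Y vY; rewrite -(onem_hazardM ay yf (f_le1 _ _)).
  have -> : addset (shift (addlate s [set v])) (v |: Y) = addset (shift s) (v |: Y).
    apply/funext => i; apply/setP => z; rewrite !inE.
    by case: (z == v); rewrite ?orbT ?orbF.
  have -> : addset (shift (addlate s [set v])) Y = addset (shift s) (v |: Y).
    by apply/funext => i; apply/setP => z; rewrite !inE orbA.
  set p1 := \prod_(_ | _) _; set p2 := \prod_(_ | _) _.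
  have -> : p1 = p2 by apply: eq_bigr => w wv; rewrite yx.
  by ring.
rewrite -!/(value k.+1 _ _) E// -{1}(upd_eq x v c) E ?upd_eq// => w wv.
by rewrite upd_neq.
Qed.

(* The value after a first step that brings the activation levels from [x] to
   [y] and in which only the nodes of [D] can be activated. *)
Definition Phi k x D s y :=
  mle (fun Y => value k y (addset s (Y :&: D))) (fun v => hazard (x v) (y v)).

(** The gain from forcing [v] now rather than one step later; [v] leaves [D] because the schedule
    alone decides about it. *)
Definition slope k x D v s y :=
  Phi k x (D :\ v) (addset s [set v]) y - Phi k x (D :\ v) (addlate s [set v]) y.

(** The level [y v] enters twice: as the weight of the branch where [v] fires, and as the
    conditioning of its threshold afterwards. The first branch is unaffected by the conditioning
    ([value_upd]); on the second, [value_late_affine] compares with forcing [v] one step late. *)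
Lemma Phi_upd k x D s y v (c : R) : v \in D -> increasing s ->
  x v <= y v -> y v <= f v (s 0%N) -> x v <= c -> c <= f v (s 0%N) ->
  Phi k x D s (upd y v c) - Phi k x D s y =
  (hazard (x v) c - hazard (x v) (y v)) * slope k x D v s y.
Proof.
move=> vD incs xy yf xc cf.
rewrite /slope /Phi mleB !(mle_split v) -sumrB big_distrr /=.
apply: eq_bigr => Y vY.
set p1 := \prod_(_ | _) _; set p2 := \prod_(_ | _) _.
have -> : p1 = p2 by apply: eq_bigr => w wv; rewrite upd_neq.
rewrite -mulrBr mulrCA; congr (_ * _).
have -> : (v |: Y) :&: (D :\ v) = Y :&: D.
  by apply/setP => z; rewrite !inE; case: eqP => [->|]; rewrite ?(negbTE vY).
have -> : Y :&: (D :\ v) = Y :&: D.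
  by apply/setP => z; rewrite !inE; case: eqP => [->|]; rewrite ?(negbTE vY).
have -> : addset s ((v |: Y) :&: D) = addset (addset s [set v]) (Y :&: D).
  by apply/funext => i; apply/setP => z; rewrite !inE; case: eqP => [->|];
     rewrite ?vD ?orbT ?orbF.
rewrite upd_eq value_upd//; first last.
- by rewrite !inE eqxx orbT.
- exact/increasing_addset/increasing_addset.
rewrite -addlate_addset.
set r := addset s (Y :&: D).
have rs : s 0%N \subset r 0%N by exact: subsetUl.
have := @value_late_affine k (x v) y r v c (increasing_addset _ incs) xy
  (le_trans yf (fmono v rs)) xc (le_trans cf (fmono v rs)).
rewrite addsetAC -/r.
set E := value k y (addset r _); set L := value k y (addlate r _).
set w1 := value k y r; set w2 := value k (upd y v c) r.
set h1 := hazard _ (y v); set h2 := hazard _ c => hE.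
(* Measured from the late value [L], the two survival terms cancel by [hE], so only [E - L]
   remains. *)
have -> : h2 * E + (1 - h2) * w2 - (h1 * E + (1 - h1) * w1) =
  (h2 - h1) * (E - L) + ((1 - h2) * (w2 - L) - (1 - h1) * (w1 - L)) by ring.
by rewrite hE subrr addr0; ring.
Qed.

Definition value_mono k := forall x s t, increasing s -> increasing t ->
  (forall i, s i \subset t i) -> below x s -> value k x s <= value k x t.

Definition value_submodular k := forall x s t, increasing s -> increasing t ->
  below x (fun i => s i :&: t i) ->
  value k x (fun i => s i :|: t i) + value k x (fun i => s i :&: t i) <=
  value k x s + value k x t.

Definition Psi k x s y := Phi k x setT s y.

(** * Diminishing returns after one step, from the induction hypothesis *)

Section Step.
Variable k : nat.
Hypotheses (mono_k : value_mono k) (sub_k : value_submodular k).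

(** If [v] is already in [t 0], the left side vanishes and monotonicity suffices. Otherwise [addset
    s [set v]] and [addlate t [set v]] have join [addset t [set v]] and meet [addlate s [set v]],
    and submodularity applies. *)
Lemma value_early_late x s t v : increasing s -> increasing t ->
  (forall i, s i \subset t i) -> below x s ->
  value k x (addset t [set v]) - value k x (addlate t [set v]) <=
  value k x (addset s [set v]) - value k x (addlate s [set v]).
Proof.
move=> incs inct st xs.
have [vt|vt] := boolP (v \in t 0%N).
  rewrite (addlate_id inct vt) subrr subr_ge0; apply: mono_k => //.
  - exact: increasing_addlate.
  - exact: increasing_addset.
  - by case=> [|i] //=; exact: subsetUl.
have := @sub_k x (addset s [set v]) (addlate t [set v])
  (increasing_addset _ incs) (increasing_addlate _ inct).
have -> : (fun i => addset s [set v] i :|: addlate t [set v] i) = addset t [set v].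
  apply/funext => -[|i]; apply/setP => z; rewrite !inE.
    have /subsetP/(_ z) := st 0%N.
    by case: (z \in s 0%N) => [->//|_]; rewrite /= orbC.
  have /subsetP/(_ z) := st i.+1.
  by case: (z \in s i.+1) => [->//|_]; case: eqP; rewrite ?orbT ?orbF.
have -> : (fun i => addset s [set v] i :&: addlate t [set v] i) = addlate s [set v].
  apply/funext => -[|i]; apply/setP => z; rewrite !inE.
    have /subsetP/(_ z) := st 0%N.
    case: eqP => [->|_].
      by rewrite (negbTE vt) orbT /=; case: (v \in s 0%N) => // /(_ isT).
    by case: (z \in s 0%N) => [->//|_].
  have /subsetP/(_ z) := st i.+1.
  by case: (z \in s i.+1) => [->//|_]; case: eqP; rewrite ?orbT ?orbF.
by move=> /(_ xs); lra.
Qed.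

Lemma below_addset x s A : below x s -> below x (addset s A).
Proof. by apply: below_sub; exact: subsetUl. Qed.

Lemma Phi_mono x D s t y : increasing s -> increasing t ->
  (forall i, s i \subset t i) -> (forall v, x v <= y v) -> below y s ->
  Phi k x D s y <= Phi k x D t y.
Proof.
move=> incs inct st xy ys; apply: ler_mle => [|Y].
  exact: (@hazard01 x _ s).
apply: mono_k; [exact: increasing_addset|exact: increasing_addset| |].
  by move=> i; apply: setSU.
exact: below_addset.
Qed.

Lemma slope_ge0 x D v s y : increasing s -> (forall w, x w <= y w) -> below y s ->
  0 <= slope k x D v s y.
Proof.
move=> incs xy ys; rewrite subr_ge0; apply: Phi_mono => //.
- exact: increasing_addlate.
- exact: increasing_addset.
- by case=> [|i] //=; exact: subsetUl.
Qed.

Lemma slope_sched x D v s t y : increasing s -> increasing t ->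
  (forall i, s i \subset t i) -> (forall w, x w <= y w) -> below y s ->
  slope k x D v t y <= slope k x D v s y.
Proof.
move=> incs inct st xy ys; rewrite /slope /Phi !mleB; apply: ler_mle => [|Y].
  exact: (@hazard01 x _ s).
rewrite ![addset (addset _ [set v]) _]addsetAC -!addlate_addset.
apply: value_early_late.
- exact: increasing_addset.
- exact: increasing_addset.
- by move=> i; apply: setSU.
- exact: below_addset.
Qed.

(** A mixed second difference: the change of the slope in [v] is a hazard increment of [w] times the
    difference of the slopes in [w] on the early and the late schedule. The early one is larger, so
    [slope_sched] gives the sign. *)
Lemma slope_upd x D v w s y (c : R) : increasing s -> w \in D -> w != v ->
  (forall u, x u <= y u) -> below y s -> y w <= c -> c <= f w (s 0%N) ->
  slope k x D v s (upd y w c) <= slope k x D v s y.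
Proof.
move=> incs wD wv xy ys yc cf; rewrite -subr_le0 /slope.
set s0 := addset s _; set s1 := addlate s _.
have incs0 : increasing s0 by exact: increasing_addset.
have incs1 : increasing s1 by exact: increasing_addlate.
have wDv : w \in D :\ v by rewrite !inE wv.
have f0 a : a <= f w (s 0%N) -> a <= f w (s0 0%N).
  by move=> /le_trans; apply; apply: fmono; exact: subsetUl.
have E0 := @Phi_upd k x _ s0 y w c wDv incs0 (xy w) (f0 _ (ys w))
  (le_trans (xy w) yc) (f0 _ cf).
have E1 := @Phi_upd k x _ s1 y w c wDv incs1 (xy w) (ys w)
  (le_trans (xy w) yc) cf.
have -> : forall a b c d : R, a - b - (c - d) = (a - c) - (b - d) by move=> *; ring.
rewrite E0 E1 -mulrBr; apply: mulr_ge0_le0.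
  by rewrite subr_ge0 hazard_mono// (le_trans cf (f_le1 _ _)).
rewrite subr_le0; apply: slope_sched => //.
by case=> [|i] //=; exact: subsetUl.
Qed.

Lemma Psi_mono x s y y' : increasing s -> (forall v, x v <= y v) ->
  (forall v, y v <= y' v) -> below y' s -> Psi k x s y <= Psi k x s y'.
Proof.
move=> incs xy yy' y's; apply: (@box_mono _ _ _ x (level (s 0%N))) => //.
move=> z v c xz zs zc cs; rewrite -subr_ge0 Phi_upd ?inE//; last first.
  by rewrite (le_trans (xz v)).
apply: mulr_ge0; last exact: slope_ge0.
by rewrite subr_ge0 hazard_mono// (le_trans cs (f_le1 _ _)).
Qed.

(** Each slope is at least as large on [s] as on [t], so [Psi] on [s] minus [Psi] on [t] is
    nondecreasing in every level. *)
Lemma Psi_sched x s t y y' : increasing s -> increasing t ->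
  (forall i, s i \subset t i) -> (forall v, x v <= y v) ->
  (forall v, y v <= y' v) -> below y' s ->
  Psi k x t y' - Psi k x t y <= Psi k x s y' - Psi k x s y.
Proof.
move=> incs inct st xy yy' y's.
suff : Psi k x s y - Psi k x t y <= Psi k x s y' - Psi k x t y' by lra.
apply: (@box_mono _ _ (fun y => Psi k x s y - Psi k x t y) x (level (s 0%N))) => //.
move=> z v c xz zs zc cs.
have ft a : a <= f v (s 0%N) -> a <= f v (t 0%N).
  by move=> /le_trans; apply; exact: fmono.
have xc : x v <= c by exact: le_trans (xz v) zc.
have := @Phi_upd k x setT s z v c (in_setT v) incs (xz v) (zs v) xc cs.
have := @Phi_upd k x setT t z v c (in_setT v) inct (xz v) (ft _ (zs v)) xc (ft _ cs).
rewrite -!/(Psi _ _ _ _) => Et Es.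
have : (hazard (x v) c - hazard (x v) (z v)) * slope k x setT v t z <=
       (hazard (x v) c - hazard (x v) (z v)) * slope k x setT v s z.
  apply: ler_wpM2l; first by rewrite subr_ge0 hazard_mono// (le_trans cs (f_le1 _ _)).
  exact: slope_sched.
by rewrite -Et -Es; lra.
Qed.

(** All second differences of [Psi] are nonpositive: those in two coordinates by [slope_upd], while
    those in a single coordinate vanish because [Psi] is affine there. Two nested uses of [box_mono]
    move the base point and the increment coordinate by coordinate. *)
Lemma Psi_increment x s y y' (e : V -> R) : increasing s ->
  (forall v, x v <= y v) -> (forall v, y v <= y' v) -> (forall v, 0 <= e v) ->
  (forall v, y' v + e v <= f v (s 0%N)) ->
  Psi k x s (fun v => y' v + e v) - Psi k x s y' <=
  Psi k x s (fun v => y v + e v) - Psi k x s y.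
Proof.
move=> incs xy yy' e0 y's.
suff : Psi k x s y - Psi k x s (fun v => y v + e v) <=
       Psi k x s y' - Psi k x s (fun v => y' v + e v) by lra.
apply: (@box_mono _ _ (fun y => Psi k x s y - Psi k x s (fun v => y v + e v)) x
  (fun v => f v (s 0%N) - e v)) => //; last by move=> v; rewrite lerBrDr.
move=> z w c xz zs zc cs.
pose d := c - z w.
have d0 : 0 <= d by rewrite subr_ge0.
pose G q := Psi k x s q - Psi k x s (upd q w (q w + d)).
suff : G z <= G (fun v => z v + e v).
  rewrite /G.
  have -> : z w + d = c by rewrite /d; ring.
  have -> : upd (fun v => z v + e v) w (z w + e w + d) = (fun v => upd z w c v + e v).
    by apply/funext => v; rewrite /upd /d; case: eqP => // ->; ring.
  lra.
(* Lowering the box by [d] in coordinate [w] keeps [q w + d] an admissible level. *)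
pose hi v := f v (s 0%N) - (if v == w then d else 0).
have hi_f v : hi v <= f v (s 0%N).
  by rewrite /hi; case: eqP => _; rewrite ?subr0// gerBl.
apply: (@box_mono _ _ G x hi) => //; last 2 first.
- by move=> v; rewrite lerDl.
- move=> v; rewrite /hi; case: eqP => [->|_]; last by rewrite subr0 -lerBrDr.
  by rewrite /d; move: cs; lra.
move=> q v r xq qhi qr rhi; rewrite /G.
have qs u : q u <= f u (s 0%N) by exact: le_trans (qhi u) (hi_f u).
have xr : x v <= r by exact: le_trans (xq v) qr.
have rs : r <= f v (s 0%N) by exact: le_trans rhi (hi_f v).
have qwd : q w + d <= f w (s 0%N).
  by have := qhi w; rewrite /hi eqxx lerBrDr.
have xwd : x w <= q w + d by rewrite (le_trans (xq w))// lerDl.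
have Eq := @Phi_upd k x setT s q w (q w + d) (in_setT w) incs (xq w) (qs w) xwd qwd.
(* Same coordinate: both increments have length [d] and are multiples of the same slope at [q],
   hence equal. *)
have [vw|vw] := eqVneq v w.
  move: rhi xr rs qr; rewrite {v}vw /hi eqxx lerBrDr => rdhi xr rs qr.
  have xrd : x w <= r + d by rewrite (le_trans xr)// lerDl.
  have E1 := @Phi_upd k x setT s q w r (in_setT w) incs (xq w) (qs w) xr rs.
  have E2 := @Phi_upd k x setT s q w (r + d) (in_setT w) incs (xq w) (qs w) xrd rdhi.
  rewrite upd_eq upd_upd.
  suff : Psi k x s (upd q w (r + d)) - Psi k x s (upd q w r) =
         Psi k x s (upd q w (q w + d)) - Psi k x s q by lra.
  have -> : Psi k x s (upd q w (r + d)) - Psi k x s (upd q w r) =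
    Phi k x setT s (upd q w (r + d)) - Psi k x s q -
    (Phi k x setT s (upd q w r) - Psi k x s q)
    by rewrite /Psi; ring.
  rewrite /Psi Eq E1 E2 -mulrBl; congr (_ * _).
  by rewrite !hazardB -!mulrBl; congr (_ / _); ring.
have xu u : x u <= upd q v r u.
  by rewrite /upd; case: eqP => [->|_]; rewrite ?xr ?xq.
have us u : upd q v r u <= f u (s 0%N).
  by rewrite /upd; case: eqP => [->|_]; rewrite ?rs ?qs.
have qw : upd q v r w = q w by rewrite upd_neq// eq_sym.
have Eu := @Phi_upd k x setT s (upd q v r) w (q w + d) (in_setT w) incs
  (xu w) (us w) xwd qwd.
rewrite qw.
suff : Psi k x s (upd (upd q v r) w (q w + d)) - Psi k x s (upd q v r) <=
       Psi k x s (upd q w (q w + d)) - Psi k x s q by lra.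
rewrite /Psi Eu Eq qw; apply: ler_wpM2l.
  by rewrite subr_ge0 hazard_mono// ?lerDl// (le_trans qwd (f_le1 _ _)).
by apply: slope_upd; rewrite ?inE.
Qed.

End Step.

Lemma valueS k x s : value k.+1 x s = Psi k x (shift s) (level (s 0%N)).
Proof. by apply: eq_mle => Y; rewrite setIT. Qed.

(** Both properties are carried through one induction, since the signs of the slopes and of their
    differences use both. *)
Lemma value_mono_submodular k : value_mono k /\ value_submodular k.
Proof.
elim: k => [|k [mono_k sub_k]].
  split => [x s t _ _ st _|x s t _ _ _] /=; [exact: Hmono|exact: Hsub].
split => [x s t incs inct st xs|x s t incs inct xst].
  have ss := increasing_shift incs; have tt := increasing_shift inct.
  have fst v : f v (s 0%N) <= f v (t 0%N) by exact: fmono.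
  rewrite !valueS.
  apply: (@le_trans _ _ (Psi k x (shift t) (level (s 0%N)))).
    by apply: Phi_mono => // [i|v]; [exact: st|exact: fmono].
  by apply: Psi_mono => // v; apply: fmono.
pose u i := s i :|: t i; pose m i := s i :&: t i.
have ss := increasing_shift incs; have tt := increasing_shift inct.
have uu : increasing (shift u) by apply/increasing_shift/increasing_cup.
have mm : increasing (shift m) by apply/increasing_shift/increasing_cap.
rewrite -/u -/m !valueS.
set a := level (s 0%N); set b := level (t 0%N).
set c := level (m 0%N); set d := level (u 0%N).
have ca v : c v <= a v by apply: fmono; exact: subsetIl.
have cb v : c v <= b v by apply: fmono; exact: subsetIr.
have ad v : a v <= d v by apply: fmono; exact: subsetUl.
have bd v : b v <= d v by apply: fmono; exact: subsetUr.
have dabc v : d v + c v <= a v + b v by exact: fsub.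
have xa v : x v <= a v by exact: le_trans (xst v) (ca v).
have as' : below a (shift s) by move=> v; apply: fmono.
have bt' : below b (shift t) by move=> v; apply: fmono.
have du' : below d (shift u) by move=> v; apply: fmono; exact: increasing_cup.
have cm' : below c (shift m) by move=> v; apply: fmono; exact: increasing_cap.
have su i : shift s i \subset shift u i by exact: subsetUl.
have tu i : shift t i \subset shift u i by exact: subsetUr.
(* The increment [d - a] is moved from base [a] down to base [c], then from the joint schedule to
   that of [t]; submodularity of [f] gives [c + (d - a) <= b]. *)
have step1 : Psi k x (shift u) d - Psi k x (shift u) a <=
             Psi k x (shift u) (fun v => c v + (d v - a v)) - Psi k x (shift u) c.
  have := @Psi_increment k mono_k sub_k x (shift u) c a (fun v => d v - a v).
  have -> : (fun v => a v + (d v - a v)) = d by apply/funext => v; ring.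
  by apply => // v; rewrite ?subr_ge0//; move: (du' v); rewrite /=; lra.
have step2 : Psi k x (shift u) (fun v => c v + (d v - a v)) - Psi k x (shift u) c <=
             Psi k x (shift t) (fun v => c v + (d v - a v)) - Psi k x (shift t) c.
  apply: Psi_sched => // v; first by rewrite lerDl subr_ge0.
  by apply: le_trans (bt' v); have := dabc v; lra.
have step3 : Psi k x (shift t) (fun v => c v + (d v - a v)) <= Psi k x (shift t) b.
  apply: Psi_mono => // v; last by have := dabc v; lra.
  by apply: (le_trans (xst v)); rewrite lerDl subr_ge0.
(* The remaining increment from [c] to [a] is moved to the schedule of [s]. All levels are then [c],
   and submodularity in the schedule holds for each outcome [Y] of the step. *)
have step4 : Psi k x (shift u) a - Psi k x (shift u) c <=
             Psi k x (shift s) a - Psi k x (shift s) c.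
  exact: Psi_sched.
have step5 : Psi k x (shift u) c + Psi k x (shift m) c <=
             Psi k x (shift s) c + Psi k x (shift t) c.
  rewrite /Psi /Phi !mleD; apply: ler_mle => [|Y].
    by apply: (@hazard01 x _ (shift m)).
  rewrite !setIT.
  have := @sub_k c (addset (shift s) Y) (addset (shift t) Y)
    (increasing_addset _ ss) (increasing_addset _ tt).
  have -> : (fun i => addset (shift s) Y i :|: addset (shift t) Y i) =
      addset (shift u) Y.
    by apply/funext => i; apply/setP => z; rewrite !inE; do 3 case: (z \in _).
  have -> : (fun i => addset (shift s) Y i :&: addset (shift t) Y i) =
      addset (shift m) Y.
    by apply/funext => i; apply/setP => z; rewrite !inE; do 3 case: (z \in _).
  by apply; exact: below_addset.
lra.
Qed.

End Value.

(** * Independent models only matter through their activation probabilities *)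

(** [reach] recurses on its last step, [value] on its first; this peels off the first step of
    [reach]. *)
Lemma reachS (V : finType) (phi : act_family V) (S : {set V}) k :
  reach phi S k.+1 = reach phi (S :|: [set v | (v \notin S) && phi v S]) k.
Proof. by elim: k => // k IHk; rewrite [LHS]/= -/(reach phi S k.+1) IHk. Qed.

Section ProductLaw.
Variables (R : realFieldType) (V : finType).
Variables (f : V -> {set V} -> R) (H : {set V} -> R).
Hypothesis fmono : forall v (A B : {set V}), A \subset B -> f v A <= f v B.
Hypothesis f_le1 : forall v A, f v A <= 1.

Lemma sum_prod_family (kappa : V -> act_fun V -> R) :
  \sum_(phi : act_family V) \prod_v kappa v (phi v) = \prod_v \sum_g kappa v g.
Proof. by rewrite bigA_distr_bigA. Qed.

(* The masses [m] are those left after conditioning the activation functions on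
   the first steps; they need not be normalized, which avoids conditioning on
   null events. *)
Lemma product_law_value k (kappa : V -> act_fun V -> R) (m x : V -> R) (S : {set V}) :
  (forall v, \sum_g kappa v g = m v) ->
  (forall v g, kappa v g != 0 -> forall A B : {set V}, A \subset B -> g A -> g B) ->
  (forall v, v \notin S -> forall A : {set V}, S \subset A ->
     \sum_(g : act_fun V | g A) kappa v g = m v * hazard (x v) (f v A)) ->
  (forall v, x v <= f v S) ->
  \sum_(phi : act_family V) (\prod_v kappa v (phi v)) * H (reach phi S k) =
  (\prod_v m v) * value f H k x (fun=> S).
Proof.
elim: k kappa m x S => [|k IHk] kappa m x S mass supp act xf.
  rewrite /= -big_distrl /= sum_prod_family; congr (_ * _).
  by apply: eq_bigr => v _; exact: mass.
pose u v := hazard (x v) (f v S).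
(* [Y] records the nodes activated first. Nodes of [S], whose membership in [Y] is immaterial, get a
   coin of bias [u v] so that the weights match those of [mle]. *)
pose r v (g : act_fun V) (b : bool) : R :=
  if v \in S then (if b then u v else 1 - u v) else (g S == b)%:R.
pose kY (Y : {set V}) v g := kappa v g * r v g (v \in Y).
transitivity (\sum_(Y : {set V}) \sum_(phi : act_family V)
    (\prod_v kY Y v (phi v)) * H (reach phi (S :|: Y) k)).
  rewrite exchange_big /=; apply: eq_bigr => phi _.
  transitivity (\sum_(Y : {set V}) (\prod_v kappa v (phi v)) *
      (\prod_v r v (phi v) (v \in Y)) * H (reach phi S k.+1)).
    rewrite -big_distrl -big_distrr /=.
    suff -> : \sum_(Y : {set V}) \prod_v r v (phi v) (v \in Y) = 1 by rewrite mulr1.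
    transitivity (\prod_v (r v (phi v) true + r v (phi v) false)).
      rewrite bigA_distr; apply: eq_bigr => Y _; apply: eq_bigr => v _.
      by case: (v \in Y).
    apply: big1 => v _; rewrite /r; case: ifP => _; first by rewrite addrC subrK.
    by case: (phi v S); rewrite ?addr0 ?add0r.
  apply: eq_bigr => Y _; rewrite big_split /=.
  have [->|r0] := eqVneq (\prod_v r v (phi v) (v \in Y)) 0.
    by rewrite !mulr0 !mul0r.
  rewrite -/(reach phi S k.+1) reachS.
  suff -> : S :|: [set v | (v \notin S) && phi v S] = S :|: Y by [].
  apply/setP => v; rewrite !inE; case vS: (v \in S) => //=.
  move/prodf_neq0: r0 => /(_ v isT); rewrite /r vS.
  by case: (phi v S =P (v \in Y)) => [->|_]; rewrite ?eqxx.
rewrite [value _ _ _ _ _]/= /mle big_distrr /=; apply: eq_bigr => Y _.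
(* After the step, nodes outside [S :|: Y] are known not to have fired at [S], so the new levels are
   those of [S]. *)
rewrite (IHk (kY Y) (fun v => m v * (if v \in Y then u v else 1 - u v)) (level f S)).
- by rewrite big_split /= mulrA.
- move=> v; rewrite /kY /r; case vS: (v \in S); first by rewrite -big_distrl /= mass.
  have ES : \sum_(g : act_fun V | g S) kappa v g = m v * u v.
    by apply: act => //; rewrite vS.
  case: (v \in Y) => /=.
    rewrite -ES [RHS]big_mkcond; apply: eq_bigr => g _.
    by case: (g S); rewrite ?mulr1 ?mulr0.
  rewrite mulrBr mulr1 -ES -mass [X in _ - X]big_mkcond -sumrB; apply: eq_bigr => g _.
  by case: (g S); rewrite ?mulr1 ?mulr0 ?subrr ?subr0.
- move=> v g; rewrite /kY mulf_eq0 negb_or => /andP[k0 _]; exact: supp k0.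
- move=> v; rewrite inE negb_or => /andP[vS vY] A SYA.
  have SA : S \subset A by exact: subset_trans (subsetUl _ _) SYA.
  rewrite (negbTE vY) -mulrA.
  have -> : (1 - u v) * hazard (level f S v) (f v A) =
            hazard (x v) (f v A) - hazard (x v) (f v S).
    have := onem_hazardM (xf v) (fmono v SA) (f_le1 v A).
    by rewrite -/(level f S v) mulrBr mulr1 /u; lra.
  rewrite mulrBr -!act// [in RHS]big_mkcond [X in _ - X]big_mkcond -sumrB big_mkcond.
  apply: eq_bigr => g _; rewrite /kY /r (negbTE vS) (negbTE vY).
  have [k0|k0] := eqVneq (kappa v g) 0.
    by rewrite k0 mul0r !if_same subrr.
  case gS: (g S); first by rewrite (supp v g k0 S A SA gS) mulr0 subrr.
  by rewrite eqxx mulr1 subr0.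
- by move=> v; apply: fmono; exact: subsetUl.
Qed.

End ProductLaw.

(** * From submodular activation probabilities to strong submodularity *)

Section Submodular.
Variables (R : realType) (V : finType) (G : sdm R V).
Hypothesis sdmG : is_sdm G.

Lemma Prob_ge0 E : 0 <= Prob G E.
Proof. by case: sdmG => law0 _ _ _; apply: sumr_ge0. Qed.

Lemma ProbT : Prob G xpredT = 1.
Proof. by case: sdmG. Qed.

Lemma ProbC E : Prob G (fun phi => ~~ E phi) = 1 - Prob G E.
Proof. by rewrite -ProbT /Prob [X in X - _](bigID E) /= [X in X - _]addrC addrK. Qed.

Lemma Prob_le1 E : Prob G E <= 1.
Proof. by rewrite -subr_ge0 -ProbC Prob_ge0. Qed.

Lemma Prob_act_mono v (A B : {set V}) : A \subset B ->
  Prob G (fun phi => phi v A) <= Prob G (fun phi => phi v B).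
Proof.
case: sdmG => law0 _ supp _ AB; rewrite /Prob big_mkcond [leRHS]big_mkcond.
apply: ler_sum => phi _; have [->|l0] := eqVneq (law G phi) 0.
  by rewrite !if_same.
have [_ /(_ _ _ AB)] := supp phi l0 v.
by case: (phi v A) => [->//|_]; case: ifP.
Qed.

Lemma Prob_act_diff v (A B : {set V}) : A \subset B ->
  Prob G (fun phi => ~~ phi v A && phi v B) =
  Prob G (fun phi => phi v B) - Prob G (fun phi => phi v A).
Proof.
case: sdmG => _ _ supp _ AB; rewrite /Prob big_mkcond.
rewrite [X in X - _]big_mkcond [X in _ - X]big_mkcond -sumrB.
apply: eq_bigr => phi _; have [->|l0] := eqVneq (law G phi) 0.
  by rewrite !if_same subrr.
have [_ /(_ _ _ AB)] := supp phi l0 v.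
by case: (phi v A) => [->//|_] /=; rewrite ?subrr// subr0.
Qed.

Lemma Prob_fiber (I : finType) (h : act_family V -> I) (E : pred (act_family V))
    (Q : pred I) :
  \sum_(i | Q i) Prob G (fun phi => E phi && (h phi == i)) =
  Prob G (fun phi => E phi && Q (h phi)).
Proof.
rewrite /Prob [RHS](partition_big h Q) => [|phi /andP[]//].
apply: eq_bigr => i Qi; apply: eq_bigl => phi.
by case: eqP => [->|]; rewrite ?andbF// Qi !andbT.
Qed.

Lemma join_outS (T : {set V}) (A B : {set nodes_out T}) : A \subset B ->
  join_out A \subset join_out B.
Proof. by move=> AB; apply/setSU/imsetS. Qed.

Lemma join_outU (T : {set V}) (A B : {set nodes_out T}) :
  join_out (A :|: B) = join_out A :|: join_out B.
Proof. by rewrite /join_out imsetU setUUl. Qed.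

Lemma join_outI (T : {set V}) (A B : {set nodes_out T}) :
  join_out (A :&: B) = join_out A :&: join_out B.
Proof. by rewrite /join_out imsetI ?setUIl// => u v _ _; exact: val_inj. Qed.

(** Conditioning on no activation by [T] turns the activation probabilities into hazards, a
    nondecreasing affine image that keeps submodularity. The reduced influence is then [value] on a
    constant schedule, started at levels 0. *)
Lemma strongly_submodular_act : independent G -> submodular (utility G) ->
  (forall v, submodular (fun A => Prob G (fun phi => phi v A))) ->
  strongly_submodular G.
Proof.
move=> indG subH subF; split=> // T redT tau.
pose F (v : V) (A : {set V}) := Prob G (fun phi => phi v A).
pose f (v : nodes_out T) (A : {set nodes_out T}) :=
  hazard (F (val v) T) (F (val v) (join_out A)).
have [_ _ supp [_ monoH _]] := sdmG.
have TJ A : T \subset @join_out _ T A by exact: subsetUr.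
have fmono v (A B : {set nodes_out T}) : A \subset B -> f v A <= f v B.
  by move=> AB; apply: hazard_mono; rewrite ?Prob_le1// Prob_act_mono// join_outS.
have f_le1 v A : f v A <= 1.
  by apply: hazard_le1; rewrite ?Prob_le1// Prob_act_mono.
have fsub v (A B : {set nodes_out T}) : f v (A :|: B) + f v (A :&: B) <= f v A + f v B.
  rewrite /f /hazard -!mulrDl ler_wpM2r ?invr_ge0 ?subr_ge0 ?Prob_le1//.
  rewrite join_outU join_outI; have := subF (val v) (join_out A) (join_out B).
  rewrite /F; lra.
have H'mono (A B : {set nodes_out T}) : A \subset B ->
    utility (reduced G T) A <= utility (reduced G T) B.
  by move=> AB; rewrite lerB// monoH// join_outS.
have H'sub : submodular (utility (reduced G T)).
  move=> A B; rewrite /= join_outU join_outI.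
  by have := subH (join_out A) (join_out B); lra.
have infl S : influence (reduced G T) tau S =
    value f (utility (reduced G T)) tau (fun=> 0) (fun=> S).
  pose kappa (v : nodes_out T) (g : act_fun (nodes_out T)) :=
    Prob G (fun phi => ~~ phi (val v) T && (restrict_out T (phi (val v)) == g)) /
    Prob G (fun phi => ~~ phi (val v) T).
  have kQ (v : nodes_out T) Q : \sum_(g | Q g) kappa v g =
      Prob G (fun phi => ~~ phi (val v) T && Q (restrict_out T (phi (val v)))) /
      Prob G (fun phi => ~~ phi (val v) T).
    by rewrite -big_distrl /= (Prob_fiber (fun phi => restrict_out T (phi (val v)))).
  rewrite /influence (product_law_value _ fmono f_le1 _ (m := fun=> 1) (x := fun=> 0)
    (kappa := kappa)) ?big1_eq ?mul1r//.
  (* Total mass 1 rests on the positive probability of the conditioning event. *)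
  - move=> v; rewrite kQ; have := redT (val v) (valP v).
    under [X in X / _]eq_bigl do rewrite andbT.
    by move=> P0; rewrite divff// gt_eqF.
  - move=> v g; rewrite mulf_eq0 negb_or => /andP[+ _].
    rewrite /Prob psumr_neq0; last by case: sdmG => law0 *; exact: law0.
    case/hasP => phi _ /andP[/andP[_ /eqP <-] l0] A B AB; rewrite !ffunE.
    have [_] := supp phi (lt0r_neq0 l0) (val v); apply.
    exact: join_outS.
  - move=> v _ A _; rewrite mul1r kQ hazard0x.
    under [X in X / _]eq_bigl do rewrite ffunE.
    by rewrite -/(Prob G _) Prob_act_diff// ProbC.
  - by move=> v; apply: hazard_ge0; rewrite ?Prob_le1// Prob_act_mono.
move=> A B; rewrite !infl.
have [_] := value_mono_submodular fmono f_le1 fsub H'mono H'sub tau.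
apply=> // v; apply: hazard_ge0; rewrite ?Prob_le1// Prob_act_mono//.
Qed.

End Submodular.

(** * Independent Cascade *)

Section SetWeight.
Variables (R : realFieldType) (V : finType).

(** Independent edges give independent sets of live in-neighbours: an edge set amounts to the family
    of its columns, and the edge weights group by head. *)
Lemma set_weight_cols (p : V * V -> R) (h : V -> {set V} -> R) :
  \sum_(L : {set V * V}) set_weight p L * \prod_v h v [set u | (u, v) \in L] =
  \prod_v \sum_(C : {set V}) set_weight (fun u => p (u, v)) C * h v C.
Proof.
rewrite bigA_distr_bigA /=.
rewrite (reindex_onto (fun F : {ffun V -> {set V}} => [set e : V * V | e.1 \in F e.2])
  (fun L => [ffun v => [set u | (u, v) \in L]])) /=; last first.
  by move=> L _; apply/setP => -[u v]; rewrite !inE ffunE inE.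
apply: eq_big => [F|F _].
  by apply/eqP/ffunP => v; rewrite ffunE; apply/setP => u; rewrite !inE.
rewrite big_split /=; congr (_ * _).
  rewrite /set_weight exchange_big /= pair_big /=.
  by apply: eq_bigr => -[u v] _; rewrite inE.
by apply: eq_bigr => v _; congr (h v _); apply/setP => u; rewrite !inE.
Qed.

End SetWeight.

Section IC.
Variables (R : realType) (V : finType) (E : {set V * V}) (p : V * V -> R).
Variable (H : {set V} -> R).
Hypothesis p01 : forall e, e \in E -> 0 <= p e <= 1.

(** Extension by 0 lets live sets range over all sets of pairs. *)
Let q e := if e \in E then p e else 0.

Lemma live_prob_weight (L : {set V * V}) :
  (if L \subset E then live_prob E p L else 0) = set_weight q L.
Proof.
have [LE|/subsetPn[e eL eE]] := boolP (L \subset E); last first.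
  by rewrite /set_weight (bigD1 e)//= eL /q (negbTE eE) mul0r.
rewrite /live_prob /set_weight [in RHS](bigID (fun e => e \in L)) /=; congr (_ * _).
  by apply: eq_bigr => e eL; rewrite eL /q (subsetP LE).
rewrite [RHS](bigID (fun e => e \in E)) /= [X in _ = _ * X]big1 ?mulr1; last first.
  by move=> e /andP[eL eE]; rewrite (negbTE eL) /q (negbTE eE) subr0.
apply: eq_big => [e|e]; first by rewrite !inE.
by rewrite !inE => /andP[eL eE]; rewrite (negbTE eL) /q eE.
Qed.

Lemma Prob_ic (Q : pred (act_family V)) :
  Prob (ic_sdm E p H) Q = \sum_(L | Q (ic_family L)) set_weight q L.
Proof.
rewrite /Prob (partition_big (@ic_family V) Q) //=; apply: eq_bigr => phi Qphi.
rewrite big_mkcond [RHS]big_mkcond; apply: eq_bigr => L _.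
rewrite -live_prob_weight andbC; case: eqP => [->|_] /=; last by rewrite andbF.
by rewrite Qphi.
Qed.

Let col_act (C : {set V}) : V -> act_fun V := fun v =>
  [ffun A : {set V} => [exists u in A :\ v, u \in C]].

Lemma ic_family_col (L : {set V * V}) v :
  ic_family L v = col_act [set u | (u, v) \in L] v.
Proof.
rewrite ffunE; apply/ffunP => A; rewrite !ffunE; apply: eq_existsb => u.
by rewrite inE.
Qed.

Lemma ic_weight_ge0 L : 0 <= set_weight q L.
Proof.
apply: set_weight_ge0 => e; rewrite /q; case: ifP => [/p01//|_].
by rewrite lexx ler01.
Qed.

Lemma ic_is_sdm : is_utility H -> is_sdm (ic_sdm E p H).
Proof.
move=> utilH; split=> //.
- move=> phi /=; rewrite big_mkcondr; apply: sumr_ge0 => L LE; case: ifP => // _.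
  by have := ic_weight_ge0 L; rewrite -live_prob_weight LE.
- by have := Prob_ic xpredT; rewrite sum_set_weight.
move=> phi /=; have [[L /eqP <- _ v]|noL] := pselect (exists L, ic_family L == phi).
  split=> [A|A B AB]; rewrite !ffunE.
    by apply: eq_existsb => u; rewrite !inE andbA andbb.
  move=> /existsP[u /andP[+ uL]]; rewrite !inE => /andP[uv uA].
  by apply/existsP; exists u; rewrite !inE uv uL (subsetP AB).
rewrite big1 ?eqxx// => L /andP[_ Lphi]; case: noL; by exists L.
Qed.

Lemma ic_independent : independent (ic_sdm E p H).
Proof.
move=> B.
(* A general [D] covers the joint event ([D = setT]) and the marginals ([D = [set v]]); columns
   outside [D] contribute total weight 1. *)
have PE (D : {set V}) (Q : pred (act_family V)) :
    (forall L, Q (ic_family L) = [forall v in D, ic_family L v \in B v]) ->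
    Prob (ic_sdm E p H) Q = \prod_(v in D) \sum_(C : {set V})
      set_weight (fun u => q (u, v)) C * (col_act C v \in B v)%:R.
  move=> QE; rewrite Prob_ic big_mkcond.
  transitivity (\prod_v \sum_(C : {set V}) set_weight (fun u => q (u, v)) C *
      (if v \in D then (col_act C v \in B v)%:R else 1)).
    rewrite -set_weight_cols; apply: eq_bigr => L _; rewrite QE.
    rewrite -big_mkcond /=; case: ifPn => [/forall_inP LB|].
      by rewrite big1 ?mulr1// => v /LB; rewrite ic_family_col => ->.
    case/forall_inPn => v vD LB.
    by rewrite (bigD1 v)//= -ic_family_col (negbTE LB) mul0r mulr0.
  rewrite [RHS]big_mkcond; apply: eq_bigr => v _; case: ifP => // _.
  rewrite -[RHS](sum_set_weight (fun u => q (u, v))).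
  by apply: eq_bigr => C _; rewrite mulr1.
rewrite (PE setT) => [|L]; last by apply: eq_forallb => v; rewrite inE.
rewrite [LHS](eq_bigl xpredT) => [|v]; last by rewrite inE.
apply: eq_bigr => v _; rewrite (PE [set v]) ?big_set1// => L.
by apply/idP/forall_inP => [Lv w /set1P ->//|]; apply; rewrite inE.
Qed.

(** For each fixed live set the activation indicator is submodular, since one live in-neighbour
    suffices; the probability is a nonnegative combination. *)
Lemma ic_submodular_act v :
  submodular (fun A => Prob (ic_sdm E p H) (fun phi => phi v A)).
Proof.
move=> A B; rewrite !Prob_ic.
rewrite [X in X + _ <= _]big_mkcond [X in _ + X <= _]big_mkcond -big_split /=.
rewrite [X in _ <= X + _]big_mkcond [X in _ <= _ + X]big_mkcond -big_split /=.
apply: ler_sum => L _; have w0 := ic_weight_ge0 L.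
pose act C := ic_family L v C.
have actU : act (A :|: B) -> act A || act B.
  rewrite /act !ffunE => /existsP[u]; rewrite !inE => /andP[/andP[uv /orP[uA|uB]] uL].
    by apply/orP; left; apply/existsP; exists u; rewrite !inE uv uA.
  by apply/orP; right; apply/existsP; exists u; rewrite !inE uv uB.
have actI : act (A :&: B) -> act A && act B.
  rewrite /act !ffunE => /existsP[u]; rewrite !inE => /andP[/and3P[uv uA uB] uL].
  by apply/andP; split; apply/existsP; exists u; rewrite !inE uv ?uA ?uB.
move: actU actI; rewrite /act.
case: (ic_family L v (A :|: B)); case: (ic_family L v (A :&: B));
  case: (ic_family L v A); case: (ic_family L v B) => //= actU actI;
  try (by have := actU isT); try (by have := actI isT); lra.
Qed.

End IC.

(** * Generalized Threshold *)

Section IGT.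
Variables (d : measure_display) (Omega : measurableType d) (R : realType).
Variables (P : probability Omega R) (V : finType).
Variables (f : V -> {set V} -> R) (theta : V -> {RV P >-> R}) (H : {set V} -> R).

Let G := igt_sdm f theta H.
Let family_at (w : Omega) := igt_family f (fun v => theta v w).

Let threshold_act v (t : R) : act_fun V := [ffun A : {set V} => t <= f v (A :\ v)].

(** There are finitely many activation functions, each cut out by finitely many half-line conditions
    on the threshold. *)
Lemma measurable_threshold_act v (B : pred (act_fun V)) :
  measurable [set t | B (threshold_act v t)]%classic.
Proof.
have -> : [set t | B (threshold_act v t)]%classic =
    (\bigcup_(g in [set g | B g]) \bigcap_(A in classical_sets.setT)
      [set t | (t <= f v (A :\ v)) = g A])%classic.
  apply/seteqP; split => [t Bt|t [g Bg gt]] /=.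
    by exists (threshold_act v t) => // A _ /=; rewrite ffunE.
  suff -> : threshold_act v t = g by [].
  by apply/ffunP => A; rewrite ffunE; exact: gt.
apply: fin_bigcup_measurable; [exact: finite_finset|] => g _.
apply: fin_bigcap_measurable; [exact: finite_finset|] => A _.
case: (g A).
  have -> : [set t | (t <= f v (A :\ v)) = true]%classic = `]-oo, f v (A :\ v)]%classic.
    by apply/seteqP; split => t /=; rewrite in_itv.
  exact: measurable_itv.
have -> : [set t | (t <= f v (A :\ v)) = false]%classic = `]f v (A :\ v), +oo[%classic.
  by apply/seteqP; split => t /=; rewrite in_itv /= andbT ltNge; case: (_ <= _).
exact: measurable_itv.
Qed.

Lemma measurable_family_at (Q : pred (act_family V)) :
  measurable [set w | Q (family_at w)]%classic.
Proof.
have -> : [set w | Q (family_at w)]%classic =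
    (\bigcup_(phi in [set phi | Q phi]) \bigcap_(v in classical_sets.setT)
      theta v @^-1` [set t | threshold_act v t == phi v])%classic.
  apply/seteqP; split => [w Qw|w [phi Qphi wphi]] /=.
    by exists (family_at w) => // v _ /=; rewrite ffunE.
  suff -> : family_at w = phi by [].
  by apply/ffunP => v; rewrite ffunE; apply/eqP; exact: (wphi v).
apply: fin_bigcup_measurable; [exact: finite_finset|] => phi _.
apply: fin_bigcap_measurable; [exact: finite_finset|] => v _.
rewrite -[X in measurable X]classical_sets.setTI; apply: measurable_funPT => //.
have mphi := measurable_threshold_act v (fun g => g == phi v); by refine mphi.
Qed.

Lemma Prob_igt (Q : pred (act_family V)) :
  Prob G Q = fine (P [set w | Q (family_at w)]%classic).
Proof.
have -> : [set w | Q (family_at w)]%classic =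
    (\bigcup_(phi in [set phi | Q phi]) [set w | family_at w = phi])%classic.
  apply/seteqP; split => [w Qw|w [phi Qphi /= ->]] //=.
  by exists (family_at w).
have mE phi : measurable [set w | family_at w = phi]%classic.
  have -> : [set w | family_at w = phi]%classic = [set w | family_at w == phi]%classic.
    by apply/seteqP; split => w /= /eqP.
  exact: (measurable_family_at (fun psi => psi == phi)).
rewrite measure_fin_bigcup//; [|exact: finite_finset|]; last first.
  by move=> phi psi _ _ [w [/= wphi wpsi]]; rewrite -wphi -wpsi.
rewrite /Prob -(@bigfs _ _ _ _ (index_enum _)) ?index_enum_uniq//; last first.
  by move=> phi _; rewrite mem_index_enum.
by rewrite -sum_fine// => phi _; exact: fin_num_measure.
Qed.

Hypothesis f01 : forall v A, 0 <= f v A <= 1.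
Hypothesis fmono : forall v, nondecreasing_setfun (f v).
Hypothesis fsub : forall v, submodular (f v).
Hypothesis indep : independent_RVs theta.
Hypothesis unif : forall v, uniform01 (theta v).

Lemma igt_is_sdm : is_utility H -> is_sdm G.
Proof.
move=> utilH; split=> //.
- by move=> phi; apply: fine_ge0.
- have := Prob_igt xpredT; rewrite /Prob => ->.
  have -> : [set w | xpredT (family_at w)]%classic = classical_sets.setT.
    by apply/seteqP; split.
  by rewrite probability_setT.
(* A family of nonzero mass is realized by some outcome, so it inherits the threshold form. *)
move=> phi l0 v; have [w <-] : exists w, family_at w = phi.
  apply/not_existsP => nophi; move/eqP: l0; apply.
  rewrite /= (_ : [set w | _]%classic = classical_sets.set0) ?measure0//.
  by apply/seteqP; split => // w /(nophi w).
split=> [A|A B AB]; rewrite !ffunE.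
  by congr (_ <= f v _); apply/setP => u; rewrite !inE andbA andbb.
by move=> /le_trans; apply; apply/fmono/setSD.
Qed.

Lemma igt_independent : independent G.
Proof.
move=> B; rewrite Prob_igt.
have := @indep setT (fun v => [set t | threshold_act v t \in B v]%classic)
  (fun v => measurable_threshold_act v (fun g => g \in B v)).
have -> : [set w | forall v, v \in setT ->
    [set t | threshold_act v t \in B v]%classic (theta v w)]%classic =
    [set w | [forall v, family_at w v \in B v]]%classic.
  apply/seteqP; split => w /= wB.
    by apply/forallP => v; rewrite ffunE; apply: wB; rewrite inE.
  by move=> v _; have /forallP/(_ v) := wB; rewrite ffunE.
move=> ->; apply: eq_big => [v|v _]; first by rewrite inE.
rewrite Prob_igt; congr (fine (P _)).
by apply/seteqP; split => w /=; rewrite ffunE.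
Qed.

Lemma Prob_act_igt v A : Prob G (fun phi => phi v A) = f v (A :\ v).
Proof.
have /andP[c0 c1] := f01 v (A :\ v); set c := f v _ in c0 c1 *.
rewrite Prob_igt.
have -> : [set w | family_at w v A]%classic = (theta v @^-1` `]-oo, c])%classic.
  by apply/seteqP; split => w /=; rewrite !ffunE in_itv.
have := unif v (measurable_itv `]-oo, c]); rewrite /distribution /pushforward => ->.
rewrite /uniform_prob integral_uniform_pdf.
have -> : (`]-oo, c] `&` `[0, 1])%classic = `[0, c]%classic.
  apply/seteqP; split => t /=; rewrite !in_itv /=.
    by move=> [-> /andP[-> _]].
  by move=> /andP[-> tc]; rewrite tc (le_trans tc).
rewrite (eq_integral (fun=> 1%E)); last first.
  move=> t; rewrite in_setE /= in_itv /= => /andP[t0 tc].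
  by rewrite /uniform_pdf t0 (le_trans tc)//= subr0 invr1.
rewrite integral_cst ?mul1e; last exact: measurable_itv.
rewrite /= lebesgue_measure_itv /= lte_fin.
(* The interval length is given by a case split on [0 < c]; in the other case [c = 0]. *)
by case: ltP => [_|c0']; rewrite ?oppr0 ?adde0//=; apply/le_anti; rewrite c0 c0'.
Qed.

Lemma igt_submodular_act v : submodular (fun A => Prob G (fun phi => phi v A)).
Proof.
move=> A B; rewrite !Prob_act_igt.
have -> : (A :|: B) :\ v = (A :\ v) :|: (B :\ v) by rewrite setDUl.
have -> : (A :&: B) :\ v = (A :\ v) :&: (B :\ v) by rewrite setDIl.
exact: fsub.
Qed.

End IGT.

Theorem theoremA2 (R : realType) (V : finType) (H : {set V} -> R)
    (utilH : is_utility H) (submodH : submodular H) :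
  (forall (E : {set V * V}) (p : V * V -> R),
     (forall e, e \in E -> 0 <= p e <= 1) ->
     strongly_submodular (ic_sdm E p H)) /\
  (forall (d : measure_display) (Omega : measurableType d)
          (P : probability Omega R)
          (f : V -> {set V} -> R) (theta : V -> {RV P >-> R}),
     (forall v A, 0 <= f v A <= 1) ->
     (forall v, nondecreasing_setfun (f v)) ->
     (forall v, submodular (f v)) ->
     independent_RVs theta ->
     (forall v, uniform01 (theta v)) ->
     strongly_submodular (igt_sdm f theta H)).
Proof.
split=> [E p p01|d Omega P f theta f01 fmono fsub indep unif].
  apply: strongly_submodular_act; first exact: ic_is_sdm.
  - exact: ic_independent.
  - exact: submodH.
  - exact: ic_submodular_act.
apply: strongly_submodular_act; first exact: igt_is_sdm.
- exact: igt_independent.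
- exact: submodH.
- exact: igt_submodular_act.
Qed.
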